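(* Let $f\in\mathbb{R}[x]$ be a polynomial in one variable of degree $d>0$ which is positive on a closed (possibly unbounded) interval $I\subset\mathbb{R}$. Let $m>0$ satisfy $m\le\min\{f(x):x\in I\}$, let $R\ge K(f)$, and let $D>0$ satisfy either $D\ge D(f,R)$, or $|f'(x)|\le D$ and $|f''(x)|\le D$ for all $|x|\le R$. Then for any integer $N>\mathcal{N}(m,R,D)$ the polynomial $\varphi_N(x)=(1+x^2)^Nf(x)$ is strongly convex on $I$.
   Context: Write $f=\sum_{i=0}^da_ix^{d-i}$ with $a_0,\ldots,a_d\in\mathbb{R}$, $a_0\ne0$. Then $$K(f)=1+2\max_{1\le i\le d}\left|\frac{a_i}{a_0}\right|^{1/i},$$ $$D(f,R)=\max\Big\{1,\ \sum_{i=0}^{d-1}(d-i)|a_i|R^{d-i-1},\ \sum_{i=0}^{d-2}(d-i)(d-i-1)|a_i|R^{d-i-2}\Big\}\quad(R>0),$$ and for positive numbers $m,R,D$, $$\mathcal{N}(m,R,D)=\max\left\{\frac{D}{m}+\frac{m}{16D},\ \frac{(1+R^2)D}{Rm}+1,\ \frac{4D^2}{m^2}+2,\ \frac{(1+R^2)D}{2m}\right\}.$$ A function $\varphi$ is strongly convex on an interval $I$ if there is $\mu>0$ such that $\varphi(x)-\frac{\mu}{2}x^2$ is convex on $I$. *)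

(* Defs.v *)
From mathcomp Require Import all_boot all_order all_algebra.
From mathcomp Require Import all_classical all_reals all_analysis.

Set Implicit Arguments.
Unset Strict Implicit.
Unset Printing Implicit Defensive.

Import Order.TTheory GRing.Theory Num.Theory.
Import numFieldNormedType.Exports.

Local Open Scope classical_set_scope.
Local Open Scope ring_scope.

Definition pdeg (R : realType) (f : {poly R}) : nat := (size f).-1.

(* Coefficients are numbered from the top: f = \sum_(i <= d) a_i 'X^(d - i)
   with d = pdeg f, so that a_0 is the leading coefficient; this is only
   meaningful for i <= d. *)
Definition acoef (R : realType) (f : {poly R}) (i : nat) : R :=
  f`_(pdeg f - i).

(* The terms of the maximum are nonnegative, so the default value 0 of the
   iterated maximum is harmless when pdeg f > 0. *)
Definition Kbound (R : realType) (f : {poly R}) : R :=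
  1 + 2 * \big[Num.max/0]_(1 <= i < (pdeg f).+1)
            (`|acoef f i / acoef f 0| `^ (i%:R^-1)).

(* In both sums the truncated subtractions are exact; for pdeg f = 1 the second
   sum is empty. *)
Definition Dbound (R : realType) (f : {poly R}) (r : R) : R :=
  let d := pdeg f in
  Num.max 1 (Num.max
    (\sum_(0 <= i < d) (d - i)%:R * `|acoef f i| * r ^+ (d - i - 1))
    (\sum_(0 <= i < d - 1)
       (d - i)%:R * (d - i - 1)%:R * `|acoef f i| * r ^+ (d - i - 2))).

Definition Nbound (R : realType) (m r D : R) : R :=
  Num.max (D / m + m / (16 * D))
  (Num.max ((1 + r ^+ 2) * D / (r * m) + 1)
  (Num.max (4 * D ^+ 2 / m ^+ 2 + 2)
           ((1 + r ^+ 2) * D / (2 * m)))).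

Definition strongly_convex_on (R : realType) (I : set R) (phi : R -> R) : Prop :=
  exists2 mu : R, 0 < mu &
    @convex_function R R^o I (fun x : R => phi x - mu / 2 * x ^+ 2).

Definition phiN (R : realType) (f : {poly R}) (N : nat) : {poly R} :=
  (1 + 'X^2) ^+ N * f.

(* Main.v *)
(** For N >= 2,
      phi_N'' = (1 + x^2)^(N-2) * ((2N(1 + x^2) + 4N(N-1)x^2) f
                + 4N x(1 + x^2) f' + (1 + x^2)^2 f''),
    and it suffices to bound the second factor below by a positive constant on
    I.  For |x| <= r this follows from f >= m, |f'| <= D, |f''| <= D and the four
    lower bounds on N.  For |x| > r >= K(f), each of f, f', f'' is dominated by
    its leading monomial, so f > 0 forces x f' > 0 and f'' >= 0, and the factor
    is at least 2Nm. *)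
Require Import Defs.
From mathcomp Require Import all_boot all_order all_algebra.
From mathcomp Require Import all_classical all_reals all_analysis.
From mathcomp Require Import ring lra zify.

Import Order.TTheory GRing.Theory Num.Theory.
Import numFieldNormedType.Exports.

Local Open Scope classical_set_scope.
Local Open Scope ring_scope.

(** * Convexity of a polynomial from its second derivative *)

Lemma horner_mvt (R : realType) (p : {poly R}) (a b : R) : a < b ->
  exists2 c : R, a < c < b & p.[b] - p.[a] = p^`().[c] * (b - a).
Proof.
move=> ab; have [] := @MVT R (horner p) (horner p^`()) a b ab.
- exact/continuous_subspaceT/continuous_horner.
- by move=> c; rewrite in_itv /= => hc ->; exists c.
Qed.

(** The mean value theorem on [[a, z]] and [[z, b]] turns the two chord slopes into values of [p']
    at [c1 < c2]; applied once more to [p'], it gives [p'(c1) <= p'(c2)]. *)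
Lemma deriv2_ge0_convex (R : realType) (p : {poly R}) (I : set R) :
    is_interval I -> (forall x, I x -> 0 <= p^`(2).[x]) ->
  @convex_function R R^o I (horner p).
Proof.
move=> hI hp.
suff hlt (t : {i01 R}) (a b : convex_lmodType R^o) : (a : R) < b -> I a -> I b ->
    p.[conv t a b] <= @conv R (convex_lmodType R^o) t p.[a] p.[b].
  move=> t a b; rewrite !inE => Ia Ib; case: (ltgtP (a : R) b) => [ab|ba|<-].
  - exact: hlt.
  - by rewrite convC [leRHS]convC; exact: hlt.
  - by rewrite !convmm.
move=> ab Ia Ib.
(* Once [t] is neither 0 nor 1, the point [z] lies strictly between [a] and [b], so both
   subintervals are nondegenerate. *)
have [->|t0] := eqVneq t 0%:i01; first by rewrite !conv0.
have [->|t1] := eqVneq t 1%:i01; first by rewrite !conv1.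
have {}t0 : 0 < t%:num by rewrite lt_neqAle eq_sym t0 ge0.
have {}t1 : t%:num < 1 by rewrite lt_neqAle t1 le1.
set s : R := t%:num in t0 t1.
change (p.[s * a + (1 - s) * b] <= s * p.[a] + (1 - s) * p.[b]).
set z : R := s * a + (1 - s) * b.
have za : z - a = (1 - s) * (b - a) by rewrite /z; ring.
have bz : b - z = s * (b - a) by rewrite /z; ring.
have d0 : 0 < b - a by rewrite subr_gt0.
have az : a < z by rewrite -subr_gt0 za mulr_gt0 // subr_gt0.
have zb : z < b by rewrite -subr_gt0 bz mulr_gt0.
have [c1 /andP[ac1 c1z] e1] := horner_mvt R p a z az.
have [c2 /andP[zc2 c2b] e2] := horner_mvt R p z b zb.
have c12 := lt_trans c1z zc2.
have [c3 /andP[c13 c32] e3] := horner_mvt R p^`() c1 c2 c12.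
have Ic3 : I c3.
  apply: (hI a b Ia Ib); apply/andP; split; apply/ltW.
    exact: lt_trans ac1 c13.
  exact: lt_trans c32 c2b.
have h : 0 <= p^`().[c2] - p^`().[c1].
  by rewrite e3 mulr_ge0 ?subr_ge0 ?(ltW c12) //; exact: hp.
have -> : p.[z] = s * p.[z] + (1 - s) * p.[z] by ring.
rewrite -subr_ge0.
have -> : s * p.[a] + (1 - s) * p.[b] - (s * p.[z] + (1 - s) * p.[z]) =
   (1 - s) * (p.[b] - p.[z]) - s * (p.[z] - p.[a]) by ring.
rewrite e1 e2 za bz.
have -> : (1 - s) * (p^`().[c2] * (s * (b - a))) - s * (p^`().[c1] * ((1 - s) * (b - a)))
  = (1 - s) * s * (b - a) * (p^`().[c2] - p^`().[c1]) by ring.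
by apply: mulr_ge0 => //; rewrite !mulr_ge0 ?subr_ge0 ?ltW.
Qed.

Lemma strongly_convex_poly (R : realType) (p : {poly R}) (I : set R) (mu : R) :
    is_interval I -> 0 < mu -> (forall x, I x -> mu <= p^`(2).[x]) ->
  strongly_convex_on I (horner p).
Proof.
move=> hI mu0 hp; exists mu => //.
rewrite [X in convex_function _ X](_ : _ = horner (p - (mu / 2) *: 'X^2)).
  apply: deriv2_ge0_convex => // x Ix; rewrite !derivnS derivn0.
  rewrite !(derivB, derivZ, derivXn, derivMn, hornerD, hornerN, hornerZ) !hornerE /=.
  have := hp _ Ix; rewrite !derivnS derivn0.
  by rewrite [_ / 2 * _]divfK ?subr_ge0 // -[1 + 1]/(2%:R) pnatr_eq0.
by apply/funext => x; rewrite !hornerE.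
Qed.

(** * The second derivative of [phiN f N] *)

(** The power of [w] stays a common factor on the left, so the rule can be applied twice in a
    row. *)
Lemma deriv_expM (R : comNzRingType) (w g : {poly R}) (n : nat) :
  (w ^+ n.+1 * g)^`() = w ^+ n * (n.+1%:R *: (w^`() * g) + w * g^`()).
Proof.
rewrite derivM deriv_exp /= scaler_nat exprS -mulr_natr -[_ *+ n.+1 in RHS]mulr_natr.
by move: w^`() (w ^+ n) n.+1%:R g^`() => w1 u k g1; ring.
Qed.

Lemma phiN_deriv2 (R : realType) (f : {poly R}) (n : nat) (x : R) (N := n.+2%:R : R) :
  (phiN f n.+2)^`(2).[x] = (1 + x ^+ 2) ^+ n *
    ((2 * N * (1 + x ^+ 2) + 4 * N * (N - 1) * x ^+ 2) * f.[x]
     + 4 * N * x * (1 + x ^+ 2) * f^`().[x] + (1 + x ^+ 2) ^+ 2 * f^`(2).[x]).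
Proof.
rewrite /phiN !derivnS derivn0 !deriv_expM.
have -> : (1 + 'X^2 : {poly R})^`() = 2 *: 'X.
  by rewrite derivD derivC derivXn add0r expr1 scaler_nat.
rewrite !(derivD, derivZ, derivM, derivC, derivXn, derivX).
have n1 : n.+1%:R = N - 1 :> R by rewrite /N -(natr1 n.+1) addrK.
rewrite n1 -/N => {n1}; move: N => N; move: f^`() f^`()^`() => f1 f2.
rewrite !(hornerE, horner_exp, hornerMn) /=.
set u := (1 + x ^+ 2) ^+ n; move: f.[x] f1.[x] f2.[x] u => y y1 y2 u.
ring.
Qed.

(** * Dominance of the leading monomial *)

(** Writing [S_n] for the sum, [S_(n+1) = c (S_n + y^n) <= 2 c y^n < y^(n+1)]. The factor 2 in
    [Kbound] comes from here. *)
Lemma sum_geometric_lt (R : realFieldType) (c y : R) (n : nat) :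
    0 <= c -> 2 * c < y ->
  \sum_(j < n) c ^+ (n - j) * y ^+ j < y ^+ n.
Proof.
move=> c0 cy; have y0 : 0 < y by lra.
elim: n => [|n IHn]; first by rewrite big_ord0 expr0.
rewrite big_ord_recr /= subSn // subnn expr1.
under eq_bigr => j _ do rewrite subSn 1?ltnW // exprS -mulrA.
rewrite -mulr_sumr -mulrDr exprS.
have yn0 : 0 < y ^+ n by rewrite exprn_gt0.
apply: (@le_lt_trans _ _ (2 * c * y ^+ n)); last by rewrite ltr_pM2r.
by rewrite [2 * c]mulrC -mulrA ler_wpM2l // mulr_natl mulr2n lerD2r ltW.
Qed.

(** With [A] the leading monomial at [x] and [B] the rest, the product is [A^2 + A B], and the
    geometric estimate gives [|B| < |A|]. *)
Lemma horner_lead_sign (R : realFieldType) (p : {poly R}) (n : nat) (c x : R) :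
    (size p <= n.+1)%N -> p`_n != 0 ->
    (forall j, (j < n)%N -> `|p`_j| <= `|p`_n| * c ^+ (n - j)) ->
    0 <= c -> 2 * c < `|x| ->
  0 < p`_n * x ^+ n * p.[x].
Proof.
move=> sp pn0 hp c0 cx.
rewrite (horner_coef_wide x sp) big_ord_recr /=.
set A := p`_n * x ^+ n; set B := \sum_(i < n) _.
have BA : `|B| < `|A|.
  apply: (@le_lt_trans _ _ (`|p`_n| * \sum_(j < n) c ^+ (n - j) * `|x| ^+ j)).
    apply: (le_trans (ler_norm_sum _ _ _)); rewrite mulr_sumr.
    apply: ler_sum => j _; rewrite normrM normrX mulrA ler_wpM2r ?exprn_ge0 //.
    exact: hp.
  by rewrite normrM normrX ltr_pM2l ?normr_gt0 // sum_geometric_lt.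
rewrite mulrDr -expr2 -real_normK ?num_real // addrC -[_ * _]opprK subr_gt0.
apply: (le_lt_trans (ler_norm _)); rewrite normrN normrM expr2 ltr_pM2l //.
exact: le_lt_trans BA.
Qed.

(** Here [c] is the maximum inside [Kbound f]; its power of exponent [i = pdeg f - j] dominates
    [|a_i / a_0|]. *)
Lemma Kbound_coef (R : realType) (f : {poly R}) (j : nat) (c := (Kbound f - 1) / 2) :
  f != 0 -> (j < pdeg f)%N ->
  `|f`_j| <= `|f`_(pdeg f)| * c ^+ (pdeg f - j).
Proof.
move=> f0 jd.
have L0 : f`_(pdeg f) != 0 by rewrite -lead_coefE lead_coef_eq0.
have -> : c = \big[Num.max/0]_(1 <= i < (pdeg f).+1)
            (`|acoef f i / acoef f 0| `^ (i%:R^-1)).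
  by rewrite /c /Kbound; lra.
set i := (pdeg f - j)%N.
have i0 : (0 < i)%N by rewrite subn_gt0.
have id : (i <= pdeg f)%N by rewrite leq_subr.
have aj : acoef f i = f`_j by rewrite /acoef subKn // ltnW.
have a0 : acoef f 0 = f`_(pdeg f) by rewrite /acoef subn0.
rewrite -ler_pdivrMl ?normr_gt0 // mulrC -normfV -normrM -aj -a0.
set q := `|_|; have q0 : 0 <= q by rewrite normr_ge0.
have -> : q = (q `^ i%:R^-1) ^+ i.
  by rewrite -powR_mulrn ?powR_ge0 // -powRrM mulVf ?powRr1 // pnatr_eq0 -lt0n.
rewrite lerXn2r ?nnegrE ?powR_ge0 ?bigmax_ge_id //.
apply: (@le_bigmax_seq _ _ _ _ _ i predT
   (fun i => `|acoef f i / acoef f 0| `^ (i%:R^-1))) => //.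
by rewrite mem_index_iota i0 ltnS.
Qed.

(** * Bounds on the derivatives for [|x| <= r] *)

Lemma horner_norm_le (R : realDomainType) (p : {poly R}) (n : nat) (r x : R) :
    (size p <= n)%N -> `|x| <= r ->
  `|p.[x]| <= \sum_(i < n) `|p`_i| * r ^+ i.
Proof.
move=> sp xr; rewrite (horner_coef_wide x sp).
apply: (le_trans (ler_norm_sum _ _ _)); apply: ler_sum => i _.
by rewrite normrM normrX ler_wpM2l // lerXn2r ?nnegrE // (le_trans _ xr).
Qed.

Lemma size_deriv_le (R : nzRingType) (p : {poly R}) (n : nat) :
  (size p <= n.+1)%N -> (size p^`() <= n)%N.
Proof.
move=> sp; have [-> | p0] := eqVneq p 0; first by rewrite deriv0 size_poly0.
by rewrite -ltnS (leq_trans _ sp) // lt_size_deriv.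
Qed.

(** The two sums in [Dbound f r] are [f'] and [f''] evaluated at [r] with coefficients replaced by
    absolute values. They run from the top coefficient down, hence the index reversals. *)
Lemma deriv_horner_norm_le_Dbound (R : realType) (f : {poly R}) (r x : R) :
  `|x| <= r -> `|f^`().[x]| <= Dbound f r /\ `|f^`(2).[x]| <= Dbound f r.
Proof.
move=> xr; rewrite /Dbound !derivnS derivn0 !le_max; split; apply/or3P.
  apply: Or32; apply: (le_trans (horner_norm_le _ _ (pdeg f) _ _ _ xr)).
    by apply: size_deriv_le; rewrite /pdeg leqSpred.
  rewrite big_mkord (reindex_inj rev_ord_inj) /=; apply: ler_sum => -[i /= hi] _.
  rewrite coef_deriv /acoef subnSK // normrMn mulr_natl.
  by rewrite -subnDA addn1.
apply: Or33; apply: (le_trans (horner_norm_le _ _ (pdeg f - 1)%N _ _ _ xr)).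
  apply: size_deriv_le; apply: size_deriv_le.
  by rewrite /pdeg; case: (size f) => [|[|n]] //=; rewrite subn1.
rewrite big_mkord (reindex_inj rev_ord_inj) /=; apply: ler_sum => -[i /= hi] _.
have e : (pdeg f - 1 - i.+1).+2 = (pdeg f - i)%N by lia.
rewrite !coef_deriv /acoef e -!mulrnA normrMn -natrM mulr_natl.
have -> : (pdeg f - 1 - i.+1).+1 = (pdeg f - i - 1)%N by lia.
have -> : (pdeg f - 1 - i.+1)%N = (pdeg f - i - 2)%N by lia.
by [].
Qed.

(** * Lower bound for [|x| <= r], and signs of the derivatives for [|x| > r] *)

(** Serves to prove an inequality by exhibiting the difference as a sum of nonnegative terms, an
    identity left to [ring]. *)
Lemma le_subr_eq (R : realDomainType) (x y z : R) : 0 <= z -> y - x = z -> x <= y.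
Proof. by move=> z0 yxz; rewrite -subr_ge0 yxz. Qed.

(* With [t = |x|], the term linear in [N] absorbs the two others when
   [t <= k = m / (4 D)]; beyond [k] the quadratic term absorbs the [y1] term. *)
Lemma convex_condition_bound (R : realType) (N m r D k x y y1 y2 : R) :
    0 < m -> 0 < D -> 1 <= N -> 4 * D * k = m ->
    (1 + k ^+ 2) * D < N * m -> (1 + k ^+ 2) * D <= (N - 1) * m * k ->
    (1 + r ^+ 2) * D <= (N - 1) * m * r -> (1 + r ^+ 2) * D < 2 * N * m ->
    `|x| <= r -> m <= y -> `|y1| <= D -> `|y2| <= D ->
  Num.min (N * m - (1 + k ^+ 2) * D) (2 * N * m - (1 + r ^+ 2) * D) <=
  (2 * N * (1 + x ^+ 2) + 4 * N * (N - 1) * x ^+ 2) * y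
    + 4 * N * x * (1 + x ^+ 2) * y1 + (1 + x ^+ 2) ^+ 2 * y2.
Proof.
move=> m0 D0 N1 km h1 hk hr h4 xr ym y1D y2D.
rewrite -[x ^+ 2]real_normK ?num_real //.
set t := `|x| in xr *; set s := 1 + t ^+ 2.
have t0 : 0 <= t by rewrite normr_ge0.
have k0 : 0 < k by nra.
have s1 : 1 <= s by rewrite /s; nra.
have xy1 : - (t * D) <= x * y1.
  have : `|x * y1| <= t * D by rewrite normrM ler_wpM2l.
  by rewrite ler_norml => /andP[].
have y2D' : - D <= y2 by move: y2D; rewrite ler_norml => /andP[].
set E := leRHS.
have NN : 0 <= N * (N - 1) by apply: mulr_ge0; lra.
(* Worst case: [y] is replaced by [m], [x * y1] by [- t D] and [y2] by [- D]. *)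
have E0 : 2 * N * s * m + 4 * N * (N - 1) * t ^+ 2 * m - 4 * N * t * s * D - s ^+ 2 * D <= E.
  have a1 : 0 <= (2 * N * s + 4 * (N * (N - 1)) * t ^+ 2) * (y - m).
    by rewrite mulr_ge0 ?subr_ge0 // addr_ge0 // !mulr_ge0 ?exprn_ge0 //; lra.
  have a2 : 0 <= 4 * N * s * (x * y1 + t * D).
    by rewrite !mulr_ge0 //; lra.
  have a3 : 0 <= s ^+ 2 * (y2 + D) by rewrite mulr_ge0 ?exprn_ge0 //; lra.
  apply: (le_subr_eq _ _ _ _ (addr_ge0 (addr_ge0 a1 a2) a3)).
  by rewrite /E; ring.
apply: le_trans E0.
case: (lerP t k) => tk.
  rewrite ge_min; apply/orP; left.
  (* As [4 D t <= m], half of [2 N s m] absorbs the [y1] term; the other half beats [s^2 D], because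
     [s <= 1 + k^2]. *)
  have a1 : 0 <= N * s * (m - 4 * D * t).
    by rewrite !mulr_ge0 ?subr_ge0 -?km ?ler_pM2l ?mulr_gt0 //; lra.
  have a2 : 0 <= s * D * (k ^+ 2 - t ^+ 2).
    by rewrite !mulr_ge0 ?subr_ge0 ?lerXn2r ?nnegrE //; lra.
  have a3 : 0 <= (s - 1) * (N * m - (1 + k ^+ 2) * D).
    by rewrite mulr_ge0 //; lra.
  have a4 : 0 <= 4 * (N * (N - 1)) * t ^+ 2 * m.
    by apply: mulr_ge0 (ltW m0); apply: mulr_ge0 (sqr_ge0 t); lra.
  apply: (le_subr_eq _ _ _ _ (addr_ge0 (addr_ge0 (addr_ge0 a1 a2) a3) a4)).
  by rewrite /s; ring.
have {}t0 : 0 < t := lt_trans k0 tk.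
have r0 : 0 < r := lt_le_trans t0 xr.
(* [t + 1 / t] is maximal at an endpoint of [k, r]; which one depends on
   whether [r * t >= 1]. *)
have ht : s * D <= (N - 1) * m * t.
  case: (lerP 1 (r * t)) => rt.
    rewrite -(ler_pM2r r0); apply: (@le_trans _ _ ((1 + r ^+ 2) * D * t)).
      rewrite -subr_ge0.
      have -> : (1 + r ^+ 2) * D * t - s * D * r = D * ((r - t) * (r * t - 1)).
        by rewrite /s; ring.
      by rewrite !mulr_ge0 ?subr_ge0 // ltW.
    by rewrite [leRHS]mulrAC ler_pM2r.
  rewrite -(ler_pM2r k0); apply: (@le_trans _ _ ((1 + k ^+ 2) * D * t)).
    rewrite -subr_ge0.
    have -> : (1 + k ^+ 2) * D * t - s * D * k = D * ((t - k) * (1 - k * t)).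
      by rewrite /s; ring.
    rewrite !mulr_ge0 ?subr_ge0 // ?(ltW D0) ?(ltW tk) //.
    by apply: le_trans (ltW rt); rewrite ler_pM2r // (le_trans (ltW tk)).
  by rewrite [leRHS]mulrAC ler_pM2r.
rewrite ge_min; apply/orP; right.
(* By [ht] the quadratic term absorbs the [y1] term, so all of [2 N s m] remains against [s^2 D],
   with [s <= 1 + r^2]. *)
have a1 : 0 <= 4 * N * t * ((N - 1) * m * t - s * D).
  by rewrite !mulr_ge0 ?subr_ge0 ?(ltW t0) //; lra.
have a2 : 0 <= s * D * (r ^+ 2 - t ^+ 2).
  by apply: mulr_ge0; [apply: mulr_ge0; lra|rewrite subr_ge0 lerXn2r ?nnegrE // ltW].
have a3 : 0 <= (s - 1) * (2 * N * m - (1 + r ^+ 2) * D).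
  by rewrite mulr_ge0 //; lra.
apply: (le_subr_eq _ _ _ _ (addr_ge0 (addr_ge0 a1 a2) a3)).
by rewrite /s; ring.
Qed.

(* Outside the disc of radius [Kbound f] each of f, f', f'' has the sign of its
   leading monomial; positivity of [f] then fixes the signs of the derivatives. *)
Lemma derivs_sign_of_pos (R : realType) (f : {poly R}) (x : R) :
    (0 < pdeg f)%N -> Kbound f < `|x| -> 0 < f.[x] ->
  0 < x * f^`().[x] /\ 0 <= f^`(2).[x].
Proof.
move=> d0 Kx fx.
have f0 : f != 0 by apply: contraTneq fx => ->; rewrite horner0 ltxx.
set c : R := (Kbound f - 1) / 2.
have c0 : 0 <= c.
  have : 0 <= \big[Num.max/0]_(1 <= i < (pdeg f).+1)
            (`|acoef f i / acoef f 0| `^ (i%:R^-1)) by exact: bigmax_ge_id.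
  by rewrite /c /Kbound; lra.
have cx : 2 * c < `|x| by rewrite /c; lra.
have x2 : 0 < x ^+ 2 by rewrite exprn_even_gt0 /= -?normr_gt0; lra.
have fc j := Kbound_coef R f j f0.
have L0 : f`_(pdeg f) != 0 by rewrite -lead_coefE lead_coef_eq0.
have sf : (size f <= (pdeg f).+1)%N by rewrite /pdeg leqSpred.
have := horner_lead_sign R f (pdeg f) c x sf L0 (fun j hj => fc j hj) c0 cx.
(* Since [f.[x]] is positive, the leading monomial of [f] is positive at [x]. *)
rewrite (pmulr_lgt0 _ fx).
move: fc L0 sf d0; rewrite -/c; case: (pdeg f) => // n fc L0 sf _ Lx.
(* Geometric domination of coefficients passes to the derivative: the lower coefficients acquire
   smaller integer factors than the leading one. *)
have deriv_coef_le (p : {poly R}) k :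
    (forall j, (j < k.+1)%N -> `|p`_j| <= `|p`_k.+1| * c ^+ (k.+1 - j)) ->
    forall j, (j < k)%N -> `|p^`()`_j| <= `|p^`()`_k| * c ^+ (k - j).
  move=> hp j jk; rewrite !coef_deriv !normrMn mulrnAl.
  apply: (@le_trans _ _ ((`|p`_k.+1| * c ^+ (k - j)) *+ j.+1)).
    by rewrite lerMn2r -subSS hp ?orbT.
  by rewrite ler_wpMn2l ?mulr_ge0 ?exprn_ge0 // ltnS ltnW.
have sf1 := size_deriv_le _ _ _ sf.
have fc1 := deriv_coef_le _ _ fc.
have L1 : f^`()`_n != 0 by rewrite coef_deriv mulrn_eq0 negb_or.
have L1x := horner_lead_sign R _ n c x sf1 L1 fc1 c0 cx.
split.
  have : 0 < (f`_n.+1 * x ^+ n.+1) * (x * f^`().[x]).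
    rewrite -(pmulrn_lgt0 _ (ltn0Sn n)).
    have -> : f`_n.+1 * x ^+ n.+1 * (x * f^`().[x]) *+ n.+1 =
      x ^+ 2 * (f^`()`_n * x ^+ n * f^`().[x]).
      by rewrite coef_deriv exprS -!mulrnAl; ring.
    exact: mulr_gt0.
  by rewrite pmulr_rgt0.
rewrite !derivnS derivn0.
(* In degree one [f''] vanishes, which is why its sign is only claimed weakly. *)
case: n => [|n] in fc L0 sf Lx sf1 fc1 L1 L1x *.
  by rewrite (size1_polyC sf1) derivC horner0.
have L2 : f^`()^`()`_n != 0 by rewrite coef_deriv mulrn_eq0 negb_or.
have := horner_lead_sign R _ n c x (size_deriv_le _ _ _ sf1) L2 (deriv_coef_le _ _ fc1) c0 cx.
rewrite !coef_deriv => h; apply: ltW.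
have : 0 < (f`_n.+2 * x ^+ n.+2) * f^`()^`().[x].
  rewrite -(pmulrn_lgt0 _ (ltn0Sn n.+1)) -(pmulrn_lgt0 _ (ltn0Sn n)).
  have -> : f`_n.+2 * x ^+ n.+2 * f^`()^`().[x] *+ n.+2 *+ n.+1 =
      x ^+ 2 * (f`_n.+2 *+ n.+2 *+ n.+1 * x ^+ n * f^`()^`().[x]).
    by rewrite !exprS -!mulrnAl; ring.
  exact: mulr_gt0.
by rewrite pmulr_rgt0.
Qed.

Theorem lemma3p3 (R : realType) (f : {poly R}) (I : set R) (m r D : R) (N : nat)
    (hd : (0 < pdeg f)%N)
    (hIitv : is_interval I) (hIclosed : closed I)
    (hpos : forall x : R, I x -> 0 < f.[x])
    (hm0 : 0 < m) (hm : forall x : R, I x -> m <= f.[x])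
    (hr : Kbound f <= r)
    (hD0 : 0 < D)
    (hD : Dbound f r <= D \/
          (forall x : R, `|x| <= r -> `|(f^`()).[x]| <= D /\ `|(f^`(2)).[x]| <= D))
    (hN : Nbound m r D < N%:R) :
  strongly_convex_on I (fun x : R => (phiN f N).[x]).
Proof.
have r1 : 1 <= r.
  apply: le_trans hr; rewrite /Kbound lerDl mulr_ge0 //.
  exact: bigmax_ge_id.
have r0 : 0 < r by lra.
have {}hD x : `|x| <= r -> `|f^`().[x]| <= D /\ `|f^`(2).[x]| <= D.
  case: hD => [hD|]; last exact.
  by move=> /(deriv_horner_norm_le_Dbound _ f)[h1 h2]; split; [exact: le_trans h1 hD|exact: le_trans h2 hD].
move: hN; rewrite /Nbound !gt_max => /and4P[h1 h2 h3 h4].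
have N2 : 2 < N%:R :> R.
  by apply: le_lt_trans h3; rewrite lerDr divr_ge0 ?mulr_ge0 ?exprn_ge0 // ltW.
(* With this [k], the first term of [Nbound] equals [(1 + k^2) D / m]. *)
set k := m / (4 * D).
have km : 4 * D * k = m by rewrite /k; field; rewrite gt_eqF.
have k0 : 0 < k by rewrite divr_gt0 ?mulr_gt0.
have h1' : (1 + k ^+ 2) * D < N%:R * m.
  rewrite -ltr_pdivrMr //; apply: le_lt_trans h1.
  by rewrite le_eqVlt; apply/orP; left; apply/eqP; rewrite /k; field; rewrite !gt_eqF.
have h2' : (1 + r ^+ 2) * D <= (N%:R - 1) * m * r.
  rewrite -mulrA [m * r]mulrC -ler_pdivrMr ?mulr_gt0 //; lra.
(* The third term of [Nbound], after substituting [m = 4 D k]. *)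
have h3' : (1 + k ^+ 2) * D <= (N%:R - 1) * m * k.
  have : 4 * D ^+ 2 + m ^+ 2 <= (N%:R - 1) * m ^+ 2.
    rewrite -ler_pdivrMr ?exprn_gt0 // mulrDl divff ?gt_eqF ?exprn_gt0 //; lra.
  rewrite -km => h; rewrite -(ler_pM2l (_ : 0 < 16 * D)) ?mulr_gt0 //.
  by nra.
have h4' : (1 + r ^+ 2) * D < 2 * N%:R * m.
  by move: h4; rewrite ltr_pdivrMr ?mulr_gt0 //; lra.
set mu1 := Num.min (N%:R * m - (1 + k ^+ 2) * D) (2 * N%:R * m - (1 + r ^+ 2) * D).
have mu1_gt0 : 0 < mu1 by rewrite lt_min !subr_gt0 h1'.
apply: (strongly_convex_poly R (phiN f N) I (Num.min mu1 (2 * N%:R * m)) hIitv).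
  by rewrite lt_min mu1_gt0 !mulr_gt0 //; lra.
move=> x Ix.
case: N => [|[|n]] in h1 h2 h3 h4 N2 h1' h2' h3' h4' mu1 mu1_gt0 *; [lra..|].
rewrite phiN_deriv2.
set E := (X in _ <= _ * X).
have s1 : 1 <= 1 + x ^+ 2 by rewrite lerDl sqr_ge0.
(* The factor [(1 + x^2)^n] is at least 1, so a positive lower bound for [E] survives multiplication
   by it. *)
suff muE : Num.min mu1 (2 * n.+2%:R * m) <= E.
  apply: (le_trans muE); rewrite ler_peMl ?exprn_ege1 //.
  by apply: le_trans muE; rewrite le_min ltW //= !mulr_ge0 // ltW.
rewrite ge_min; case: (lerP `|x| r) => xr; apply/orP.
  have [f1 f2] := hD x xr.
  left; apply: convex_condition_bound => //; [lra|exact: hm].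
right; have [f1 f2] := derivs_sign_of_pos R f x hd (le_lt_trans hr xr) (hpos x Ix).
have fx := hm x Ix.
have x2 := sqr_ge0 x.
(* For [|x| > r], [E - 2 N m] splits into four nonnegative terms. *)
have b1 : 0 <= 2 * n.+2%:R * (f.[x] - m) by rewrite !mulr_ge0 // subr_ge0.
have b2 : 0 <= (2 * n.+2%:R + 4 * n.+2%:R * (n.+2%:R - 1)) * x ^+ 2 * f.[x].
  apply: mulr_ge0 (ltW (hpos x Ix)); apply: mulr_ge0 x2.
  by rewrite addr_ge0 ?mulr_ge0 //; lra.
have b3 : 0 <= 4 * n.+2%:R * (1 + x ^+ 2) * (x * f^`().[x]).
  by apply: mulr_ge0 (ltW f1); rewrite mulr_ge0 ?mulr_ge0 //; lra.
have b4 : 0 <= (1 + x ^+ 2) ^+ 2 * f^`(2).[x] by rewrite mulr_ge0 ?exprn_ge0 //; lra.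
apply: (le_subr_eq _ _ _ _ (addr_ge0 (addr_ge0 (addr_ge0 b1 b2) b3) b4)).
by rewrite /E; ring.
Qed.
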